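(* Let $n\ge2$, let $u_1,\dots,u_n\in\mathbb{R}^d$ be unit vectors, and let $A=(a_{kl})_{k,l=1}^n\in\mathbb{R}^{n\times n}$ be a positive semidefinite matrix. Then there exists a unit vector $v\in\mathbb{R}^d$, with $\langle u_k,v\rangle\neq0$ for every $k$, such that $$\sum_{k,l=1}^n\frac{a_{kl}}{\langle u_k,v\rangle\,\langle u_l,v\rangle}\le n\,\mathrm{tr}\,A.$$
   Context: $\langle\cdot,\cdot\rangle$ is the standard Euclidean inner product on $\mathbb{R}^d$. *)

(* Defs.v *)
From HB Require Import structures.
From mathcomp Require Import all_boot all_order all_algebra.
From mathcomp Require Import reals.

Set Implicit Arguments.
Unset Strict Implicit.
Unset Printing Implicit Defensive.

Import Order.TTheory GRing.Theory Num.Theory.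
Local Open Scope ring_scope.

Definition dot (R : realType) (d : nat) (x y : 'rV[R]_d) : R :=
  \sum_(i < d) x 0 i * y 0 i.

(* The norm MathComp-Analysis puts on 'rV[R]_d is the sup norm, hence this
   separate Euclidean norm. *)
Definition enorm (R : realType) (d : nat) (x : 'rV[R]_d) : R :=
  Num.sqrt (dot x x).

(* As usual for real matrices, positive semidefiniteness includes symmetry. *)
Definition psd (R : realType) (n : nat) (A : 'M[R]_n) : Prop :=
  A \is symmetricmx /\ forall x : 'rV[R]_n, 0 <= (x *m A *m x^T) 0 0.

(* Main.v *)
Require Import Defs.
From HB Require Import structures.
From mathcomp Require Import all_classical topology normedtype derive.
From mathcomp Require Import all_boot all_order all_fingroup all_algebra.
From mathcomp Require Import reals ring lra.

(** Let G be the Gram matrix of the u_k.  A point y of R^n is called stationary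
    when y_k (G y)_k = 1 for every k, which says that y is a critical point of
    y^T G y / 2 - sum_k ln |y_k|.  For such a y the vector w = sum_k y_k u_k
    satisfies <u_k, w> = 1 / y_k and |w|^2 = y^T G y = n, so v = w / sqrt n is a
    unit vector for which the sum in the theorem equals n (y^T A y).  It is
    therefore enough to find a stationary y with y^T A y <= tr A.

    Suppose first that G is positive definite.  Then each of the 2^n open
    orthants contains a stationary point (exists_sign_stationary), and the point
    we want is found by averaging over these 2^n points with suitable positive
    weights.  Put M(t) = I + diag(t) G.  Its determinant is multi-affine,
    det M(t) = sum_S g_S t^S over the subsets S of the indices, with g_0 = 1 for
    the empty set 0.  If y and z are distinct stationary points and t = (y_k z_k),
    then M(t)^T kills y - z, so that det M(t) = 0, whereas det M(t) > 0 when
    y = z.  Writing t^S = y^S z^S, this says that the square matrices (y^S g_S),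
    with rows indexed by stationary points and columns by subsets, and
    (z^S / det M(z^2)) are inverse to each other.  Their product in the other
    order is then also the identity, and the column of the empty set reads
      sum_y w_y y^T = [T is empty],      w_y = 1 / det M(y^2) > 0
    (stationary_moments).  The w_y are thus a probability measure for which
    E[y_i y_j] = 0 if i <> j, and averaging y_i (G y)_i = 1 gives
    G_ii E[y_i^2] = 1.  Hence E[y^T A y] = sum_i A_ii / G_ii, and some stationary
    point is at most the average (exists_stationary_le).

    If G is singular, some orthants lose their stationary point.  The positive
    definite case is then applied to G + d I and to A + e I: the second term
    keeps the selected points bounded, so a limit point as d -> 0 exists
    (exists_penalized_stationary).  Letting e -> 0 requires no compactness, since
    G has at most one stationary point per orthant (stationary_sign_uniq) and
    y^T A y takes finitely many values on them. *)

Set Implicit Arguments.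
Unset Strict Implicit.
Unset Printing Implicit Defensive.

Import Order.TTheory GRing.Theory Num.Theory.
Import numFieldNormedType.Exports.
Local Open Scope ring_scope.

(** * Moments of the stationary points *)

(** The identity PQ = 1 => QP = 1 for square matrices, read entrywise with an
    arbitrary finite index type; both factors have to be indexed by the same
    type, which is why stationary points are later indexed by subsets. *)
Lemma biorthogonal_sym (F : fieldType) (T : finType) (f g : T -> T -> F) :
  (forall a c, \sum_b f a b * g b c = (a == c)%:R) ->
  forall b d, \sum_c g b c * f c d = (b == d)%:R.
Proof.
move=> fg b d.
pose P : 'M[F]_#|T| := \matrix_(i, j) f (enum_val i) (enum_val j).
pose Q : 'M[F]_#|T| := \matrix_(i, j) g (enum_val i) (enum_val j).
have PQ : P *m Q = 1%:M.
  apply/matrixP => i j; rewrite !mxE -[in RHS](inj_eq enum_val_inj) -fg.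
  rewrite (reindex _ (onW_bij _ (@enum_val_bij T))) /=.
  by apply: eq_bigr => k _; rewrite !mxE.
have /matrixP/(_ (enum_rank b) (enum_rank d)) := mulmx1C PQ.
rewrite !mxE (inj_eq enum_rank_inj) => <-.
rewrite (reindex _ (onW_bij _ (@enum_val_bij T))) /=.
by apply: eq_bigr => k _; rewrite !mxE !enum_rankK.
Qed.

Section Algebra.
Variables (R : realType) (n : nat).
Implicit Types (G A : 'M[R]_n) (t y z : 'I_n -> R) (S : {set 'I_n}).

Definition qform G y : R := \sum_i \sum_j G i j * (y i * y j).

Definition one_plus_scaled G t : 'M[R]_n :=
  \matrix_(i, j) ((i == j)%:R + t i * G i j).

(** The principal minor of G on S, in its Leibniz expansion over all
    permutations: a term survives only if the permutation fixes the complement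
    of S. *)
Definition minor_coef G S : R :=
  \sum_(s : 'S_n) (-1) ^+ s *
    \prod_i (if i \in S then G i (s i) else (i == s i)%:R).

Lemma det_one_plus_scaled G t :
  \det (one_plus_scaled G t) = \sum_S minor_coef G S * \prod_(i in S) t i.
Proof.
under [RHS]eq_bigr => S _ do rewrite mulr_suml.
rewrite exchange_big /=; apply: eq_bigr => s _.
under [RHS]eq_bigr => S _ do rewrite -mulrA.
rewrite -mulr_sumr; congr (_ * _).
under eq_bigr => i _ do rewrite mxE addrC.
rewrite bigA_distr; apply: eq_bigr => S _.
rewrite [X in _ = _ * X]big_mkcond -big_split /=; apply: eq_bigr => i _.
by case: ifP => _; rewrite ?mulr1 // mulrC.
Qed.

Lemma minor_coef0 G : minor_coef G set0 = 1.
Proof.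
rewrite -(det1 R n); apply: eq_bigr => s _; congr (_ * _).
by apply: eq_bigr => i _; rewrite inE !mxE.
Qed.

(** The polynomial p(x) = det (I + x diag(t) G) equals 1 at 0 and has no root
    x >= 0: a row v in the kernel would satisfy
    sum_j t_j v_j^2 + x (tv)^T G (tv) = 0.  By the intermediate value property
    p is positive at 1. *)
Lemma det_one_plus_scaled_gt0 G t :
  (forall y, 0 <= qform G y) -> (forall i, 0 < t i) ->
  0 < \det (one_plus_scaled G t).
Proof.
move=> Gpsd t_gt0.
pose p : {poly R} :=
  \sum_S (minor_coef G S * \prod_(i in S) t i) *: 'X^#|S|.
have pE x : p.[x] = \det (one_plus_scaled G (fun i => x * t i)).
  rewrite det_one_plus_scaled horner_sum; apply: eq_bigr => S _.
  by rewrite hornerZ hornerXn big_split /= prodr_const mulrAC mulrA.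
have p_neq0 x : 0 <= x -> p.[x] != 0.
  move=> x_ge0; rewrite pE; apply/det0P => -[v v_neq0 vM].
  have col j : v 0 j + x * \sum_i v 0 i * t i * G i j = 0.
    have /matrixP/(_ 0 j) := vM; rewrite !mxE => vMj.
    rewrite -[RHS]vMj mulr_sumr.
    rewrite -[X in X + _](big_pred1_eq +%R j (fun i => v 0 i)).
    rewrite big_mkcond /= -big_split /=; apply: eq_bigr => i _; rewrite !mxE.
    by case: eqP => _; rewrite ?mulr1n ?mulr0n; ring.
  have qE : \sum_j t j * v 0 j ^+ 2 + x * qform G (fun i => t i * v 0 i) = 0.
    transitivity
      (\sum_j t j * v 0 j * (v 0 j + x * \sum_i v 0 i * t i * G i j)).
      rewrite /qform exchange_big /= mulr_sumr -big_split /=.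
      apply: eq_bigr => j _; rewrite mulrDr; congr (_ + _); first by ring.
      by rewrite mulrCA; congr (_ * _); rewrite !mulr_sumr;
        apply: eq_bigr => i _; ring.
    by rewrite big1 // => j _; rewrite col mulr0.
  have sq_ge0 j : 0 <= t j * v 0 j ^+ 2 by rewrite mulr_ge0 ?sqr_ge0 // ltW.
  have := qE => /eqP.
  rewrite paddr_eq0 ?sumr_ge0 ?mulr_ge0 // => /andP[/eqP s0 _].
  move/eqP: v_neq0; apply; apply/rowP => j; rewrite mxE.
  have tv0 : t j * v 0 j ^+ 2 = 0.
    by apply: (psumr_eq0P (fun i _ => sq_ge0 i) s0).
  by move/eqP: tv0; rewrite mulf_eq0 gt_eqF //= sqrf_eq0 => /eqP.
have p0 : p.[0] = 1.
  rewrite pE -(det1 R n); congr (\det _); apply/matrixP => i j.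
  by rewrite !mxE !mul0r addr0.
have -> : \det (one_plus_scaled G t) = p.[1].
  by rewrite pE; congr (\det _); apply/matrixP => i j; rewrite !mxE mul1r.
rewrite ltNge; apply/negP => p1.
have [|x /andP[x_ge0 _]] := @poly_ivt R (- p) 0 1 ler01.
  by rewrite !hornerN p0 oppr_ge0 p1 oppr_le0 ler01.
by rewrite rootE hornerN oppr_eq0; apply/negP/p_neq0.
Qed.

Definition stationary G y := forall k, y k * (\sum_j G k j * y j) = 1.

Lemma stationary_neq0 G y k : stationary G y -> y k != 0.
Proof.
by move=> /(_ k); apply: contra_eq_neq => ->; rewrite mul0r eq_sym oner_eq0.
Qed.

(** Since G y = 1/y and G z = 1/z entrywise, the transpose I + G diag(yz) kills
    the row vector y - z: the result is (y - z) + (1/y - 1/z) yz = 0. *)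
Lemma det_stationary_pair G y z :
  (forall i j, G i j = G j i) -> stationary G y -> stationary G z ->
  (exists k, y k != z k) -> \det (one_plus_scaled G (fun i => y i * z i)) = 0.
Proof.
move=> Gsym ys zs [k yzk]; apply/eqP; rewrite -det_tr; apply/det0P.
exists (\row_i (y i - z i)).
  apply: contra yzk => /eqP/rowP/(_ k); rewrite !mxE => /eqP.
  by rewrite subr_eq0.
apply/rowP => i; rewrite !mxE.
transitivity ((y i - z i) + z i * (y i * (\sum_j G i j * y j))
                - y i * (z i * (\sum_j G i j * z j))).
  2: by rewrite ys zs; ring.
transitivity ((y i - z i) + \sum_j y i * z i * (G i j * y j - G i j * z j)).
  rewrite -[X in X + _](big_pred1_eq +%R i (fun j => y j - z j)).
  rewrite big_mkcond /= -big_split /=; apply: eq_bigr => j _; rewrite !mxE.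
  by rewrite [i == j]eq_sym; case: eqP => _; rewrite ?mulr1n ?mulr0n; ring.
by rewrite -mulr_sumr sumrB; ring.
Qed.

(** With one stationary point per sign pattern there are as many points as
    monomials y^S, so the orthogonality relations given by the determinants
    between points turn into relations between monomials. *)
Lemma stationary_moments G (y : {set 'I_n} -> 'I_n -> R) :
    (forall i j, G i j = G j i) -> (forall z, 0 <= qform G z) ->
    (forall S, stationary G (y S)) -> (forall S k, (0 < y S k) = (k \in S)) ->
  exists2 w : {set 'I_n} -> R, forall S, 0 < w S &
    forall T : {set 'I_n}, \sum_S w S * \prod_(i in T) y S i = (T == set0)%:R.
Proof.
move=> Gsym Gpsd ystat ysgn.
pose D S S' := \det (one_plus_scaled G (fun i => y S i * y S' i)).
have D_gt0 S : 0 < D S S.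
  apply: det_one_plus_scaled_gt0 => // i.
  by rewrite -expr2 exprn_even_gt0 //= (stationary_neq0 _ (ystat S)).
exists (fun S => (D S S)^-1) => [S|T]; first by rewrite invr_gt0.
pose f S S' := minor_coef G S' * \prod_(i in S') y S i.
pose g S' S := (\prod_(i in S') y S i) / D S S.
have := @biorthogonal_sym _ _ f g _ T set0 => <- => [|S S'].
  by apply: eq_bigr => S _; rewrite /f /g minor_coef0 big_set0 !mulr1 mulrC.
have -> : \sum_b f S b * g b S' = D S S' / D S' S'.
  rewrite /D det_one_plus_scaled mulr_suml; apply: eq_bigr => b _.
  by rewrite /f /g big_split /= !mulrA.
have [->|SS'] := eqVneq S S'; first by rewrite divff ?gt_eqF.
rewrite /D det_stationary_pair ?mul0r //.
apply/existsP; apply: contraR SS'; rewrite negb_exists => /forallP yE.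
apply/eqP/setP => k; rewrite -!ysgn.
by have := yE k; rewrite negbK => /eqP ->.
Qed.

(** The moments of degree 2 make the average of y^T A y over the stationary
    points equal to the right-hand side. *)
Lemma exists_stationary_le G A (y : {set 'I_n} -> 'I_n -> R) :
    (forall i j, G i j = G j i) -> (forall z, 0 <= qform G z) ->
    (forall S, stationary G (y S)) -> (forall S k, (0 < y S k) = (k \in S)) ->
  exists S, qform A (y S) <= \sum_i A i i / G i i.
Proof.
move=> Gsym Gpsd ystat ysgn.
have [w w_gt0 wy] := stationary_moments Gsym Gpsd ystat ysgn.
have w1 : \sum_S w S = 1.
  have := wy set0; rewrite eqxx mulr1n => <-.
  by apply: eq_bigr => S _; rewrite big_set0 mulr1.
have w_off i j : i != j -> \sum_S w S * (y S i * y S j) = 0.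
  move=> ij; transitivity (\sum_S w S * \prod_(k in [set i; j]) y S k).
    by apply: eq_bigr => S _; rewrite big_setU1 ?inE //= big_set1.
  by rewrite wy; case: eqP => // /setP/(_ i); rewrite !inE eqxx.
have w_diag i : G i i * \sum_S w S * (y S i * y S i) = 1.
  transitivity (\sum_j G i j * \sum_S w S * (y S i * y S j)).
    rewrite (bigD1 i) //= [X in _ + X]big1 ?addr0 // => j ji.
    by rewrite w_off ?mulr0 // eq_sym.
  rewrite -w1; under eq_bigr do rewrite mulr_sumr.
  rewrite exchange_big; apply: eq_bigr => S _ /=.
  rewrite -[RHS]mulr1 -(ystat S i) !mulr_sumr; apply: eq_bigr => j _; ring.
have avg : \sum_S w S * qform A (y S) = \sum_i A i i / G i i.
  transitivity (\sum_i \sum_j A i j * \sum_S w S * (y S i * y S j)).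
    under eq_bigr do rewrite mulr_sumr.
    rewrite exchange_big /=; apply: eq_bigr => i _.
    under eq_bigr do rewrite mulr_sumr.
    rewrite exchange_big /=; apply: eq_bigr => j _.
    by rewrite mulr_sumr; apply: eq_bigr => S _; rewrite mulrCA.
  apply: eq_bigr => i _.
  rewrite (bigD1 i) //= [X in _ + X]big1 ?addr0 => [|j ji].
    congr (_ * _); have Gii : G i i != 0.
      by apply: contra_eq_neq (w_diag i) => ->; rewrite mul0r eq_sym oner_eq0.
    by apply: (mulfI Gii); rewrite w_diag divff.
  by rewrite w_off ?mulr0 // eq_sym.
apply/existsP; apply: contraT; rewrite negb_exists => /forallP lt_avg.
suff : 0 < \sum_S w S * (qform A (y S) - \sum_i A i i / G i i).
  under eq_bigr do rewrite mulrBr.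
  by rewrite sumrB avg -mulr_suml w1 mul1r subrr ltxx.
have pos S : 0 < w S * (qform A (y S) - \sum_i A i i / G i i).
  by rewrite mulr_gt0 // subr_gt0 ltNge.
by rewrite (bigD1 set0) //= ltr_pwDl ?pos // sumr_ge0 // => S _; exact/ltW.
Qed.

(** Strict convexity of y^T G y / 2 - sum ln |y_k| in an orthant, in the form
    (y - z)^T G (y - z) + sum_k (y_k - z_k)^2 / (y_k z_k) = 0. *)
Lemma stationary_sign_uniq G y z :
    (forall z, 0 <= qform G z) -> stationary G y -> stationary G z ->
  (forall k, (0 < y k) = (0 < z k)) -> y =1 z.
Proof.
move=> Gpsd ystat zstat ysgn.
pose e k := (y k - z k) ^+ 2 / (y k * z k).
have yz_gt0 k : 0 < y k * z k.
  have := ysgn k.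
  have := stationary_neq0 k ystat; have := stationary_neq0 k zstat.
  rewrite !neq_lt => /orP[] zk /orP[] yk;
    rewrite ?zk ?yk ?[0 < y k]ltNge ?[0 < z k]ltNge ?(ltW yk) ?(ltW zk) //=.
    by rewrite nmulr_lgt0.
  by rewrite mulr_gt0.
have e_ge0 k : 0 <= e k by rewrite divr_ge0 ?sqr_ge0 // ltW.
have qE : qform G (fun k => y k - z k) + \sum_k e k = 0.
  rewrite /qform -big_split /= big1 // => k _.
  transitivity
    ((y k - z k) * ((\sum_j G k j * y j) - (\sum_j G k j * z j)) + e k).
    rewrite -sumrB mulr_sumr; congr (_ + _); apply: eq_bigr => j _; ring.
  have yk := stationary_neq0 k ystat; have zk := stationary_neq0 k zstat.
  have -> : \sum_j G k j * y j = (y k)^-1.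
    by apply: (mulfI yk); rewrite ystat divff.
  have -> : \sum_j G k j * z j = (z k)^-1.
    by apply: (mulfI zk); rewrite zstat divff.
  by rewrite /e; field; rewrite yk zk.
have se_ge0 : 0 <= \sum_k e k by apply: sumr_ge0.
have e0 : \sum_k e k = 0.
  by move/eqP: qE; rewrite paddr_eq0 // => /andP[_ /eqP].
move=> k.
have /eqP : e k = 0 by apply: (psumr_eq0P (fun i _ => e_ge0 i) e0).
by rewrite mulf_eq0 invr_eq0 (gt_eqF (yz_gt0 k)) orbF sqrf_eq0 subr_eq0 => /eqP.
Qed.

End Algebra.
(** * Extrema over boxes *)

Section Compactness.
Local Open Scope classical_set_scope.
Variables (R : realType) (n : nat).
Implicit Types (G A : 'M[R]_n) (y z : 'I_n -> R).

(** Continuity is stated on functions of coordinate families, because the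
    quadratic forms take such families while the topology lives on row vectors. *)
Definition vcont (f : ('I_n -> R) -> R) :=
  continuous (fun v : 'rV[R]_n => f (v 0)).

Lemma vcont_cst (c : R) : vcont (fun=> c).
Proof. exact: cst_continuous. Qed.

Lemma vcont_coord i : vcont (fun y => y i).
Proof. exact: coord_continuous. Qed.

Lemma vcontD f g : vcont f -> vcont g -> vcont (fun y => f y + g y).
Proof. by move=> fc gc v; exact: (cvgD (fc v) (gc v)). Qed.

Lemma vcontM f g : vcont f -> vcont g -> vcont (fun y => f y * g y).
Proof. by move=> fc gc v; exact: (cvgM (fc v) (gc v)). Qed.

Lemma vcont_sum (I : finType) (f : I -> ('I_n -> R) -> R) :
  (forall i, vcont (f i)) -> vcont (fun y => \sum_i f i y).
Proof.
move=> fc; apply: continuous_big => [|i _]; last exact: fc.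
exact: add_continuous.
Qed.

Lemma vcont_prod (I : finType) (f : I -> ('I_n -> R) -> R) :
  (forall i, vcont (f i)) -> vcont (fun y => \prod_i f i y).
Proof.
move=> fc; apply: continuous_big => [|i _]; last exact: fc.
exact: mul_continuous.
Qed.

Lemma vcont_qform A : vcont (qform A).
Proof.
apply: vcont_sum => i; apply: vcont_sum => j.
by apply: vcontM; [exact: vcont_cst|apply: vcontM; exact: vcont_coord].
Qed.

Lemma box_EVT_min (f h : ('I_n -> R) -> R) (a b : R) :
    vcont f -> vcont h ->
    (exists2 y, forall i, a <= y i <= b & 0 <= h y) ->
  exists y, [/\ forall i, a <= y i <= b, 0 <= h y &
    forall z, (forall i, a <= z i <= b) -> 0 <= h z -> f y <= f z].
Proof.
move=> fc hc [y0 y0ab hy0].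
have row_fun (z : 'I_n -> R) : (\row_i z i) 0 = z.
  by apply/funext => i; rewrite mxE.
pose K := [set v : 'rV[R]_n | forall i, `[a, b]%classic (v ord0 i)] `&`
          [set v : 'rV[R]_n | 0 <= h (v 0)].
have K_compact : compact K.
  apply: compact_closedI.
    exact: (rV_compact (fun=> @segment_compact R a b)).
  move/continuous_closedP: hc => /(_ [set x | 0 <= x]); apply.
  exact: closed_ge.
have KP z : K (\row_i z i) <-> (forall i, a <= z i <= b) /\ 0 <= h z.
  rewrite /K /= row_fun; split=> -[zab hz]; split=> // i; move: (zab i);
    by rewrite mxE in_itv.
have K_neq0 : K !=set0 by exists (\row_i y0 i); apply/KP.
have [v /set_mem Kv v_min] :=
  EVT_min_rV K_neq0 K_compact (continuous_subspaceT fc).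
case: Kv => vab hv; exists (v 0); split=> // z zab hz.
by have := v_min (\row_i z i); rewrite row_fun; apply; apply/mem_set/KP.
Qed.

End Compactness.

(** * A stationary point in every orthant *)

Section Existence.
Variables (R : realType) (n : nat).
Implicit Types (G A : 'M[R]_n) (y z : 'I_n -> R).

Lemma qformD G y z : (forall i j, G i j = G j i) ->
  qform G (fun i => y i + z i) =
    qform G y + 2 * \sum_i z i * (\sum_j G i j * y j) + qform G z.
Proof.
move=> Gsym; have cross : \sum_i \sum_j G i j * (y i * z j) =
    \sum_i z i * (\sum_j G i j * y j).
  rewrite exchange_big; apply: eq_bigr => i _; rewrite mulr_sumr.
  by apply: eq_bigr => j _; rewrite Gsym; ring.
rewrite mulrDl mul1r -{1}cross /qform -!big_split /=; apply: eq_bigr => i _.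
by rewrite mulr_sumr -!big_split /=; apply: eq_bigr => j _; ring.
Qed.

Lemma qformZ G c y : qform G (fun i => c * y i) = c ^+ 2 * qform G y.
Proof.
rewrite /qform mulr_sumr; apply: eq_bigr => i _.
by rewrite mulr_sumr; apply: eq_bigr => j _; ring.
Qed.

Lemma qform_le_abs G y b : (forall i, `|y i| <= b) ->
  qform G y <= (\sum_i \sum_j `|G i j|) * b ^+ 2.
Proof.
move=> yb; rewrite /qform mulr_suml; apply: ler_sum => i _.
rewrite mulr_suml; apply: ler_sum => j _.
rewrite (le_trans (ler_norm _)) // normrM ler_wpM2l ?normr_ge0 //.
by rewrite normrM expr2 ler_pM.
Qed.

(** First-order condition for minimising y^T G y at a fixed product of the
    coordinates: multiplying y_k by 1 + h and dividing y_l by 1 + h changes the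
    form by 2 h (y_k (G y)_k - y_l (G y)_l) + O(h^2). *)
Lemma pair_stationary_le G y k l :
    (forall i j, G i j = G j i) -> (forall i, 0 < y i) ->
    (forall z, (forall i, 0 < z i) -> \prod_i z i = \prod_i y i ->
      qform G y <= qform G z) ->
  y l * (\sum_j G l j * y j) <= y k * (\sum_j G k j * y j).
Proof.
move=> Gsym y_gt0 y_min; have [->//|kl] := eqVneq k l.
set Gk := \sum_j G k j * y j; set Gl := \sum_j G l j * y j.
rewrite leNgt; apply/negP => lt_kl.
pose M := (\sum_i \sum_j `|G i j|) * (y k + y l) ^+ 2.
have M_ge0 : 0 <= M by rewrite mulr_ge0 ?sqr_ge0 // !sumr_ge0 // => i _; rewrite sumr_ge0.
have step h : 0 < h < 1 -> 0 <= 2 * (y k * Gk - y l * Gl / (1 + h)) + h * M.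
  move=> /andP[h_gt0 h_lt1]; have h1 : 0 < 1 + h by lra.
  pose e i := (i == k)%:R * y k - (i == l)%:R * (y l / (1 + h)).
  have ek : e k = y k by rewrite /e eqxx (negbTE kl) mul1r mul0r subr0.
  have el : e l = - (y l / (1 + h)) by rewrite /e eqxx eq_sym (negbTE kl) mul1r mul0r sub0r.
  have e0 i : i != k -> i != l -> e i = 0.
    by rewrite /e => /negbTE-> /negbTE->; rewrite !mul0r subr0.
  have yl_le : y l / (1 + h) <= y l by rewrite ler_pdivrMr // ler_peMr ?ltW //; lra.
  have yl_gt0 : 0 < y l / (1 + h) by rewrite divr_gt0.
  have zk : y k + h * e k = y k * (1 + h) by rewrite ek; ring.
  have zl : y l + h * e l = y l / (1 + h) by rewrite el; field; rewrite gt_eqF.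
  have e_sum (F : 'I_n -> R) : \sum_i h * e i * F i = h * (y k * F k - y l / (1 + h) * F l).
    rewrite (bigD1 k) //= (bigD1 l) 1?eq_sym //= big1 => [|i /andP[ik il]].
      by rewrite ek el; ring.
    by rewrite e0 // mulr0 mul0r.
  have := y_min (fun i => y i + h * e i).
  have z_gt0 i : 0 < y i + h * e i.
    have [->|ik] := eqVneq i k; first by rewrite zk mulr_gt0.
    have [->|il] := eqVneq i l; first by rewrite zl.
    by rewrite e0 // mulr0 addr0.
  have z_prod : \prod_i (y i + h * e i) = \prod_i y i.
    have lk : l != k by rewrite eq_sym.
    rewrite (bigD1 k) //= (bigD1 l) //= zk zl.
    rewrite [RHS](bigD1 k) //= [in RHS](bigD1 l) //=.
    under eq_bigr => i /andP[ik il] do rewrite e0 // mulr0 addr0.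
    by field; rewrite gt_eqF.
  move=> /(_ z_gt0 z_prod); rewrite qformD // e_sum qformZ -/Gk -/Gl => le_q.
  have qe : qform G e <= M.
    apply: qform_le_abs => i.
    have [->|ik] := eqVneq i k; first by rewrite ek gtr0_norm // lerDl ltW.
    have [->|il] := eqVneq i l; last by rewrite e0 // normr0 addr_ge0 // ltW.
    by rewrite el normrN gtr0_norm // (le_trans yl_le) // lerDr ltW.
  have {}qe : h ^+ 2 * qform G e <= h ^+ 2 * M by rewrite ler_wpM2l ?sqr_ge0.
  rewrite -(pmulr_rge0 _ h_gt0).
  have -> : y l * Gl / (1 + h) = y l / (1 + h) * Gl by ring.
  by lra.
pose c := y l * Gl - y k * Gk; pose N := 2 * `|y k * Gk| + 2 * M.
have c_gt0 : 0 < c by rewrite subr_gt0.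
have N_ge0 : 0 <= N by rewrite addr_ge0 // mulr_ge0.
(* Any h in ]0, 1[ with h N <= c does; the + 1 keeps h below 1. *)
pose h := c / (c + N + 1).
have den_gt0 : 0 < c + N + 1 by lra.
have h_gt0 : 0 < h by rewrite divr_gt0.
have h_lt1 : h < 1 by rewrite ltr_pdivrMr // mul1r; lra.
have hN : h * N <= c.
  by rewrite /h mulrAC ler_pdivrMr // ler_pM2l //; lra.
have := step h; rewrite h_gt0 h_lt1 => /(_ isT).
have h1 : 0 < 1 + h by lra.
rewrite -(pmulr_rge0 _ h1) => st.
have {}st : 0 <= 2 * (y k * Gk * (1 + h) - y l * Gl) + (1 + h) * (h * M).
  apply: (le_trans st); rewrite le_eqVlt; apply/orP; left; apply/eqP.
  by field; rewrite gt_eqF.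
have hk : h * (y k * Gk) <= h * `|y k * Gk| by rewrite ler_pM2l // ler_norm.
have hM : h * (h * M) <= h * M by rewrite ler_piMl ?(ltW h_lt1) // mulr_ge0 // ltW.
move: st hk hM hN c_gt0; rewrite /N /c; clearbody h.
move: (y k * Gk) (y l * Gl) `|_| => p q r st hk hM hN c_gt0.
lra.
Qed.

(** A minimiser of y^T G y over the positive y with product at least 1 has all
    y_k (G y)_k equal, to some mu > 0, and dividing it by sqrt mu makes it
    stationary. *)
Lemma exists_pos_stationary G (d : R) :
    (forall i j, G i j = G j i) -> 0 < d ->
    (forall y, d * (\sum_i y i ^+ 2) <= qform G y) ->
  exists2 y, stationary G y & forall i, 0 < y i.
Proof.
move=> Gsym d_gt0 Gd.
have [k0 _ | no_k] := pickP 'I_n; last by exists (fun=> 1) => i; have := no_k i.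
have q_ge0 y : 0 <= qform G y.
  by apply: le_trans (Gd y); rewrite mulr_ge0 ?(ltW d_gt0) // sumr_ge0 // => i _; exact: sqr_ge0.
(* Outside the box [0, B]^n the form is at least its value q1 at (1, ..., 1), so a
   minimiser over the box is global; B >= 1 also puts that point inside. *)
pose q1 := qform G (fun=> 1); pose B := 1 + q1 / d.
have B_ge1 : 1 <= B by rewrite lerDl divr_ge0 ?q_ge0 // ltW.
have dB : q1 <= d * B ^+ 2.
  have -> : q1 = d * (B - 1) by rewrite /B; field; rewrite gt_eqF.
  by rewrite ler_pM2l // lerBlDr (le_trans (ler_peMr _ B_ge1)) ?(le_trans ler01) // -expr2 lerDl.
have h_cont : vcont (fun y : 'I_n -> R => \prod_i y i + (-1)).
  by apply: vcontD; [apply: vcont_prod => i; exact: vcont_coord|exact: vcont_cst].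
have [|y [yB y_prod y_min]] := @box_EVT_min _ _ (qform G) _ 0 B (@vcont_qform _ _ G) h_cont.
  by exists (fun=> 1) => [i|]; rewrite ?ler01 //= big1 // subrr.
have {}y_prod : 1 <= \prod_i y i by rewrite -subr_ge0.
have y_gt0 i : 0 < y i.
  have /andP[yi_ge0 _] := yB i; rewrite lt_def yi_ge0 andbT.
  by apply: contraTneq y_prod => yi0; rewrite (bigD1 i) //= yi0 mul0r -ltNge ltr01.
have {}y_min z : (forall i, 0 < z i) -> \prod_i z i = \prod_i y i ->
    qform G y <= qform G z.
  move=> z_gt0 z_prod; have [/forallP zB|] := boolP [forall i, z i <= B].
    by apply: y_min => [i|]; rewrite ?(ltW (z_gt0 i)) ?zB // z_prod subr_ge0.
  rewrite negb_forall => /existsP[i]; rewrite -ltNge => Bz.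
  apply: (@le_trans _ _ q1).
    by apply: y_min => [j|]; rewrite ?ler01 ?B_ge1 // big1 // subrr.
  apply: le_trans dB (le_trans _ (Gd z)); rewrite ler_pM2l // (bigD1 i) //=.
  apply: (@le_trans _ _ (z i ^+ 2)).
    by rewrite ler_pXn2r ?nnegrE ?(ltW Bz) ?(ltW (z_gt0 i)) // (le_trans ler01).
  by rewrite lerDl sumr_ge0 // => j _; exact: sqr_ge0.
pose mu := y k0 * (\sum_j G k0 j * y j).
have mu_eq k : y k * (\sum_j G k j * y j) = mu.
  by apply/eqP; rewrite eq_le; apply/andP; split; apply: pair_stationary_le.
have mu_gt0 : 0 < mu.
  rewrite ltNge; apply/negP => mu_le0.
  have : qform G y <= 0.
    have -> : qform G y = \sum_(k < n) mu.
      apply: eq_bigr => k _; rewrite -(mu_eq k) mulr_sumr.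
      by apply: eq_bigr => j _; ring.
    by apply: sumr_le0.
  apply/negP; rewrite -ltNge; apply: lt_le_trans (Gd y); rewrite mulr_gt0 //.
  rewrite (bigD1 k0) //= ltr_pwDl ?exprn_gt0 // sumr_ge0 // => j _; exact: sqr_ge0.
pose r := (Num.sqrt mu)^-1.
have r_gt0 : 0 < r by rewrite invr_gt0 sqrtr_gt0.
have r2 : r * r * mu = 1.
  by rewrite -expr2 exprVn sqr_sqrtr ?ltW // mulVf // gt_eqF.
exists (fun i => r * y i) => [k|i]; last by rewrite mulr_gt0.
rewrite -r2 -(mu_eq k) !mulr_sumr; apply: eq_bigr => j _; ring.
Qed.

(** Conjugating G by a diagonal sign matrix moves any orthant to the positive
    one. *)
Lemma exists_sign_stationary G (d : R) :
    (forall i j, G i j = G j i) -> 0 < d ->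
    (forall y, d * (\sum_i y i ^+ 2) <= qform G y) ->
  forall S : {set 'I_n},
    exists y, stationary G y /\ forall i, (0 < y i) = (i \in S).
Proof.
move=> Gsym d_gt0 Gd S; pose s i : R := if i \in S then 1 else -1.
have s2 i : s i * s i = 1 by rewrite /s; case: ifP => _; ring.
pose G' : 'M[R]_n := \matrix_(i, j) (s i * s j * G i j).
have [||y ystat y_gt0] := @exists_pos_stationary G' d _ d_gt0.
- by move=> i j; rewrite !mxE Gsym; ring.
- move=> y; have := Gd (fun i => s i * y i).
  rewrite (eq_bigr (fun i => y i ^+ 2)) => [|i _]; last first.
    by rewrite exprMn expr2 s2 mul1r.
  move=> /le_trans; apply; rewrite le_eqVlt; apply/orP; left; apply/eqP.
  by apply: eq_bigr => i _; apply: eq_bigr => j _; rewrite mxE; ring.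
exists (fun i => s i * y i); split=> [k|i].
  rewrite -(ystat k) !mulr_sumr; apply: eq_bigr => j _; rewrite mxE; ring.
rewrite /s; case: ifP => _; first by rewrite mul1r y_gt0.
by rewrite mulN1r oppr_gt0 lt_gtF.
Qed.

End Existence.

(** * Singular Gram matrices *)

Section Limit.
Variables (R : realType) (n : nat).
Implicit Types (G A : 'M[R]_n) (y z : 'I_n -> R).

Lemma qformD_scalar A (c : R) y :
  qform (A + c%:M) y = qform A y + c * \sum_i y i ^+ 2.
Proof.
rewrite /qform mulr_sumr -big_split /=; apply: eq_bigr => i _.
rewrite (eq_bigr (fun j => A i j * (y i * y j) + (if j == i then c * y i ^+ 2 else 0))).
  by rewrite big_split -big_mkcond /= big_pred1_eq.
move=> j _; rewrite !mxE [i == j]eq_sym mulrDl; congr (_ + _).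
by case: eqP => [->|_]; rewrite ?mulr1n ?mulr0n ?mul0r // expr2.
Qed.

Lemma qform_diag_ge0 A i : (forall z, 0 <= qform A z) -> 0 <= A i i.
Proof.
move=> /(_ (fun j => (j == i)%:R)); rewrite /qform.
rewrite (bigD1 i) //= [X in _ + X]big1 => [|j ji]; last first.
  by rewrite big1 // => k _; rewrite (negbTE ji) mul0r mulr0.
rewrite addr0 (bigD1 i) //= big1 => [|j ji]; last by rewrite (negbTE ji) !mulr0.
by rewrite eqxx !mulr1 addr0.
Qed.

(** The penalty e |y|^2 confines the points supplied by exists_stationary_le for
    G + d I to one box, whatever d.  They are stationary for G up to the error
    d y_k^2, so the squared defect f has minimum 0 on the box. *)
Lemma exists_penalized_stationary G A (e : R) :
    (forall i j, G i j = G j i) -> (forall z, 0 <= qform G z) ->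
    (forall i, G i i = 1) -> (forall z, 0 <= qform A z) -> 0 < e ->
  exists2 y, stationary G y & qform A y + e * (\sum_i y i ^+ 2) <= \tr A + n%:R * e.
Proof.
move=> Gsym Gpsd Gii Apsd e_gt0.
set c := \tr A + n%:R * e.
have c_ge0 : 0 <= c.
  by rewrite addr_ge0 ?mulr_ge0 ?(ltW e_gt0) // sumr_ge0 // => i _; exact: qform_diag_ge0.
(* 0 <= h y forces y_i^2 <= c / e, and c / e <= B <= B^2. *)
pose B := 1 + c / e.
have B_ge1 : 1 <= B by rewrite lerDl divr_ge0 // ltW.
pose h y := c - qform (A + e%:M) y.
pose f y := \sum_k (y k * (\sum_j G k j * y j) - 1) ^+ 2.
have hc : vcont h.
  apply: vcontD; first exact: vcont_cst.
  have -> : (fun y => - qform (A + e%:M) y) = (fun y => (-1) * qform (A + e%:M) y).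
    by apply/funext => y; rewrite mulN1r.
  by apply: vcontM; [exact: vcont_cst|exact: vcont_qform].
have fc : vcont f.
  have gc k : vcont (fun y => y k * (\sum_j G k j * y j) - 1).
    apply: vcontD; last exact: vcont_cst.
    apply: vcontM; first exact: vcont_coord.
    by apply: vcont_sum => j; apply: vcontM; [exact: vcont_cst|exact: vcont_coord].
  by apply: vcont_sum => k; exact: (vcontM (@gc k) (@gc k)).
have h_box y : 0 <= h y -> forall i, - B <= y i <= B.
  rewrite /h subr_ge0 qformD_scalar => hy i; rewrite -ler_norml.
  have yi : y i ^+ 2 <= c / e.
    rewrite ler_pdivlMr // mulrC; apply: le_trans hy; apply: ler_wpDl => //.
    rewrite ler_pM2l // (bigD1 i) //= lerDl sumr_ge0 // => j _; exact: sqr_ge0.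
  rewrite -(@ler_pXn2r _ 2) ?nnegrE // ?(le_trans ler01) // real_normK ?num_real //.
  apply: (le_trans yi); apply: (@le_trans _ _ B); first by rewrite lerDr.
  by rewrite expr2 ler_peMl // (le_trans ler01).
have approx d : 0 < d -> exists2 y, 0 <= h y & f y <= n%:R * (d * B ^+ 2) ^+ 2.
  move=> d_gt0; pose Gd := G + d%:M.
  have Gd_sym i j : Gd i j = Gd j i by rewrite !mxE Gsym eq_sym.
  have Gd_ge y : d * (\sum_i y i ^+ 2) <= qform Gd y by rewrite qformD_scalar lerDr.
  have [y yP] := fin_all_exists (exists_sign_stationary Gd_sym d_gt0 Gd_ge).
  have Gd_psd z : 0 <= qform Gd z.
    apply: le_trans (Gd_ge z); rewrite mulr_ge0 ?(ltW d_gt0) // sumr_ge0 // => i _.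
    exact: sqr_ge0.
  have [S yS] := exists_stationary_le (A + e%:M) Gd_sym Gd_psd
    (fun S => proj1 (yP S)) (fun S => proj2 (yP S)).
  have hS : 0 <= h (y S).
    rewrite subr_ge0; apply: (le_trans yS).
    have -> : c = \sum_i (A i i + e).
      by rewrite big_split /= sumr_const card_ord /c mulr_natl.
    apply: ler_sum => i _; rewrite !mxE eqxx !mulr1n Gii.
    rewrite ler_pdivrMr ?addr_gt0 // ler_peMr ?lerDl ?(ltW d_gt0) //.
    by rewrite addr_ge0 ?(ltW e_gt0) ?qform_diag_ge0.
  exists (y S) => //.
  have -> : n%:R * (d * B ^+ 2) ^+ 2 = \sum_(k < n) (d * B ^+ 2) ^+ 2.
    by rewrite sumr_const card_ord mulr_natl.
  apply: ler_sum => k _.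
  have -> : y S k * (\sum_j G k j * y S j) - 1 = - (d * y S k ^+ 2).
    rewrite -(proj1 (yP S) k).
    have -> : \sum_j Gd k j * y S j = \sum_j G k j * y S j + d * y S k.
      rewrite (eq_bigr (fun j => G k j * y S j + (if j == k then d * y S k else 0))).
        by rewrite big_split -big_mkcond /= big_pred1_eq.
      move=> j _; rewrite !mxE [k == j]eq_sym mulrDl; congr (_ + _).
      by case: eqP => [->|_]; rewrite ?mulr1n ?mulr0n ?mul0r.
    by ring.
  have y2_ge0 := sqr_ge0 (y S k).
  have y2B : y S k ^+ 2 <= B ^+ 2.
    by rewrite -real_normK ?num_real // ler_pXn2r ?nnegrE // ?ler_norml ?h_box // (le_trans ler01).
  have dB_ge0 x : 0 <= d * x ^+ 2 by rewrite mulr_ge0 ?sqr_ge0 // ltW.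
  by rewrite sqrrN ler_pXn2r ?nnegrE ?dB_ge0 // ler_pM2l.
have [|y [yB hy y_min]] := @box_EVT_min _ _ f h (- B) B fc hc.
  by have [y hy _] := approx 1 ltr01; exists y => //; exact: h_box.
exists y; last by rewrite -subr_ge0 -qformD_scalar.
have f_ge0 z : forall k, 0 <= (z k * (\sum_j G k j * z j) - 1) ^+ 2.
  by move=> k; exact: sqr_ge0.
have fy0 : f y = 0.
  apply/eqP; rewrite eq_le sumr_ge0 ?andbT // leNgt; apply/negP => fy_gt0.
  pose N := n%:R * (B ^+ 2) ^+ 2.
  have N_ge0 : 0 <= N by rewrite mulr_ge0 // sqr_ge0.
  (* Then d < 1 and d N < f y, whereas the approximate point has defect at most
     d^2 N. *)
  pose d := f y / (f y + N + 1).
  have den_gt0 : 0 < f y + N + 1 by lra.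
  have d_gt0 : 0 < d by rewrite divr_gt0.
  have d_lt1 : d < 1 by rewrite ltr_pdivrMr // mul1r; lra.
  have [z hz fz] := approx d d_gt0.
  have := y_min z (h_box z hz) hz; apply/negP; rewrite -ltNge.
  apply: (le_lt_trans fz).
  have -> : n%:R * (d * B ^+ 2) ^+ 2 = d * (d * N) by rewrite /N; ring.
  apply: (@le_lt_trans _ _ (d * N)); first by rewrite ler_piMl ?(ltW d_lt1) // mulr_ge0 // ltW.
  by rewrite /d mulrAC ltr_pdivrMr // ltr_pM2l //; lra.
move=> k; apply/eqP; rewrite -subr_eq0 -sqrf_eq0.
by apply/eqP; apply: (psumr_eq0P (fun k _ => f_ge0 y k) fy0).
Qed.

(** The finitely many orthants give a uniform gap m if every stationary point
    has y^T A y > tr A; a penalty with n e < m then contradicts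
    exists_penalized_stationary. *)
Lemma exists_stationary_le_trace G A :
    (forall i j, G i j = G j i) -> (forall z, 0 <= qform G z) ->
    (forall i, G i i = 1) -> (forall z, 0 <= qform A z) ->
  exists2 y, stationary G y & qform A y <= \tr A.
Proof.
move=> Gsym Gpsd Gii Apsd; apply: contrapT => no_y.
have no_le y : stationary G y -> \tr A < qform A y.
  by move=> ystat; rewrite ltNge; apply/negP => yA; apply: no_y; exists y.
have gap (S : {set 'I_n}) : exists c : R, 0 < c /\ forall y, stationary G y ->
    (forall k, (0 < y k) = (k \in S)) -> \tr A + c <= qform A y.
  have [[y0 [y0stat y0S]]|noS] :=
      pselect (exists y, stationary G y /\ forall k, (0 < y k) = (k \in S)).
    exists (qform A y0 - \tr A); split=> [|y ystat yS]; first by rewrite subr_gt0 no_le.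
    have /funext-> : y =1 y0 by apply: (stationary_sign_uniq Gpsd) => // k; rewrite yS y0S.
    by rewrite addrC subrK.
  by exists 1; split=> // y ystat yS; case: noS; exists y.
have [c cP] := fin_all_exists gap.
pose m : R := \big[Num.min/1]_S c S.
have m_gt0 : 0 < m by apply: lt_bigmin => // S _; case: (cP S).
pose e : R := m / (n%:R + 1).
have n1_gt0 : 0 < n%:R + 1 :> R by rewrite ltr_wpDl.
have e_gt0 : 0 < e by rewrite divr_gt0.
have [y ystat yA] := exists_penalized_stationary Gsym Gpsd Gii Apsd e_gt0.
pose S := [set k | 0 < y k].
have := proj2 (cP S) y ystat => /(_ (fun k => _)) yc.
have {}yc : \tr A + c S <= qform A y by apply: yc => k; rewrite inE.
have mS : m <= c S by exact: bigmin_le.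
have ne : n%:R * e < m.
  by rewrite /e mulrCA gtr_pMr // ltr_pdivrMr // mul1r ltrDl.
have : 0 <= e * \sum_i y i ^+ 2.
  by rewrite mulr_ge0 ?(ltW e_gt0) // sumr_ge0 // => i _; exact: sqr_ge0.
lra.
Qed.

End Limit.

(** * From stationary points to vectors *)

Lemma psd_qform_ge0 (R : realType) (n : nat) (A : 'M[R]_n) (z : 'I_n -> R) :
  psd A -> 0 <= qform A z.
Proof.
move=> [_ /(_ (\row_i z i))]; congr (_ <= _); rewrite !mxE /qform exchange_big.
apply: eq_bigr => j _; rewrite !mxE mulr_suml; apply: eq_bigr => i _.
by rewrite !mxE; ring.
Qed.

Section Gram.
Variables (R : realType) (n d : nat) (u : 'I_n -> 'rV[R]_d).
Implicit Types (x : 'rV[R]_d) (y : 'I_n -> R).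

Definition gram : 'M[R]_n := \matrix_(i, j) dot (u i) (u j).

Lemma dot_ge0 x : 0 <= dot x x.
Proof. by apply: sumr_ge0 => i _; rewrite -expr2 sqr_ge0. Qed.

Lemma dot_sumr x y :
  dot x (\sum_j y j *: u j) = \sum_j dot x (u j) * y j.
Proof.
rewrite /dot; under [RHS]eq_bigr do rewrite mulr_suml.
rewrite exchange_big; apply: eq_bigr => i _ /=.
rewrite summxE mulr_sumr; apply: eq_bigr => j _; rewrite mxE; ring.
Qed.

Lemma qform_gram y :
  qform gram y = dot (\sum_j y j *: u j) (\sum_j y j *: u j).
Proof.
rewrite dot_sumr /qform exchange_big; apply: eq_bigr => j _ /=.
have dotC (a b : 'rV[R]_d) : dot a b = dot b a.
  by apply: eq_bigr => i _; rewrite mulrC.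
rewrite dotC dot_sumr mulr_suml; apply: eq_bigr => i _.
by rewrite mxE (dotC (u i)); ring.
Qed.

End Gram.

Theorem corollary7 (R : realType) (n d : nat) (u : 'I_n -> 'rV[R]_d)
    (A : 'M[R]_n) (hn : (2 <= n)%N)
    (hu : forall k, enorm (u k) = 1) (hA : psd A) :
  exists v : 'rV[R]_d,
    [/\ enorm v = 1,
        forall k, dot (u k) v != 0
      & \sum_(k < n) \sum_(l < n) A k l / (dot (u k) v * dot (u l) v)
          <= n%:R * \tr A].
Proof.
have Gsym i j : gram u i j = gram u j i.
  by rewrite !mxE; apply: eq_bigr => k _; rewrite mulrC.
have Gpsd z : 0 <= qform (gram u) z by rewrite qform_gram dot_ge0.
have Gii i : gram u i i = 1.
  by rewrite mxE -[LHS]sqr_sqrtr ?dot_ge0 // -/(enorm _) hu expr1n.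
have [y ystat yA] := exists_stationary_le_trace Gsym Gpsd Gii (fun z => psd_qform_ge0 z hA).
pose w := \sum_j y j *: u j; pose s : R := Num.sqrt n%:R.
have s_gt0 : 0 < s by rewrite sqrtr_gt0 ltr0n (leq_trans _ hn).
have s2 : s ^+ 2 = n%:R by rewrite sqr_sqrtr.
have y_neq0 k : y k != 0 := stationary_neq0 k ystat.
have dot_w k : dot (u k) w = (y k)^-1.
  apply: (mulfI (y_neq0 k)); rewrite divff // -[RHS](ystat k) dot_sumr.
  by under [in RHS]eq_bigr do rewrite mxE.
have norm_w : dot w w = s ^+ 2.
  rewrite -qform_gram s2 /qform -[in RHS](card_ord n) -sumr_const; apply: eq_bigr => k _.
  by rewrite -[RHS](ystat k) mulr_sumr; apply: eq_bigr => j _; ring.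
have dot_v k : dot (u k) (s^-1 *: w) = (s * y k)^-1.
  rewrite invfM -dot_w /dot mulr_sumr; apply: eq_bigr => i _.
  by rewrite mxE mulrCA.
exists (s^-1 *: w); split=> [|k|].
- have -> : enorm (s^-1 *: w) = Num.sqrt (s^-1 ^+ 2 * dot w w).
    congr Num.sqrt; rewrite /dot mulr_sumr; apply: eq_bigr => i _.
    by rewrite !mxE; ring.
  by rewrite norm_w -exprMn mulVf ?gt_eqF // expr1n sqrtr1.
- by rewrite dot_v invr_eq0 mulf_neq0 // gt_eqF.
apply: le_trans (ler_wpM2l (ler0n R n) yA).
rewrite le_eqVlt; apply/orP; left; apply/eqP.
rewrite -s2 /qform mulr_sumr; apply: eq_bigr => k _.
rewrite mulr_sumr; apply: eq_bigr => l _.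
by rewrite !dot_v invfM !invrK; ring.
Qed.
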